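(* Let $h$ be a tree drawn from the symmetric BART tree prior. For any fixed $x,x'\in[0,1]^p$, $$\mathbb{P}[x\sim_h x']=\sum_{k=1}^\infty\big(1-d_{\mathrm{BART}}(x,x')\big)^k f_D(k),$$ where $d_{\mathrm{BART}}(x,x')=\sum_{v=1}^p f_V(v)\,|F_S(x_v)-F_S(x'_v)|$.
   Context: Symmetric tree prior. Fix an integer $p\ge1$, a probability mass function $f_D$ on the positive integers, a probability mass function $f_V$ on $\{1,\dots,p\}$ with $f_V(v)>0$ for all $v$, and a continuous, strictly positive probability density $f_S$ on $[0,1]$ with distribution function $F_S$. The structure of a symmetric tree $h$ is drawn as: $D\sim f_D$; given $D$, independently $V_1,\dots,V_D$ i.i.d. from $f_V$ and $S_1,\dots,S_D$ i.i.d. from $f_S$. The leaves are indexed by $l\in\{-1,1\}^D$; a point $x\in[0,1]^p$ belongs to leaf $l$ if for every $k\le D$, $x_{V_k}<S_k$ when $l_k=1$ and $x_{V_k}\ge S_k$ when $l_k=-1$. Write $x\sim_h x'$ for the event that $x$ and $x'$ belong to the same leaf of $h$. *)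

(* Defs.v *)
From HB Require Import structures.
From mathcomp Require Import all_boot all_order all_algebra.
From mathcomp Require Import all_classical all_reals all_analysis.

Set Implicit Arguments.
Unset Strict Implicit.
Unset Printing Implicit Defensive.

Import Order.TTheory GRing.Theory Num.Theory.
Import numFieldNormedType.Exports.

Local Open Scope classical_set_scope.
Local Open Scope ring_scope.

Section SymmetricTree.
Variables (R : realType) (p : nat).

(* The decision rules are shared by all the nodes of a given level, so that a
   symmetric tree is determined by one rule (V_k, S_k) per level k; levels and
   coordinates are numbered from 0. *)
Record symmetric_tree := SymmetricTree {
  depth : nat;
  split_var : 'I_depth -> 'I_p;
  split_val : 'I_depth -> R }.

(* Leaf labels in {-1, 1}^depth: [true] stands for 1, [false] for -1. *)
Definition leaf (h : symmetric_tree) := {ffun 'I_(depth h) -> bool}.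

Definition in_leaf (h : symmetric_tree) (l : leaf h) (x : 'rV[R]_p) : Prop :=
  forall k : 'I_(depth h),
    if l k then x 0 (split_var k) < split_val k
    else split_val k <= x 0 (split_var k).

Definition same_leaf (h : symmetric_tree) (x x' : 'rV[R]_p) : Prop :=
  exists l : leaf h, in_leaf l x /\ in_leaf l x'.

Definition tree_cylinder (d : nat) (v : 'I_d -> 'I_p) (A : 'I_d -> set R) :
    set symmetric_tree :=
  [set SymmetricTree v s | s in [set s | forall k, A k (s k)]].

(* The sigma-algebra on trees is generated by the cylinders: on each of the
   countably many pieces with given depth d and split variables v, it is the
   product Borel sigma-algebra of R^d. *)
Definition tree_cylinders : set (set symmetric_tree) :=
  [set C | exists d (v : 'I_d -> 'I_p) (A : 'I_d -> set R),
    (forall k, measurable (A k)) /\ C = tree_cylinder v A].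

Definition root_only_tree : symmetric_tree :=
  @SymmetricTree 0
    (fun k : 'I_0 => False_rect 'I_p (notF (ltn_ord k)))
    (fun _ : 'I_0 => 0).

HB.instance Definition _ := gen_eqMixin symmetric_tree.
HB.instance Definition _ := gen_choiceMixin symmetric_tree.
HB.instance Definition _ := isPointed.Build symmetric_tree root_only_tree.

Definition measurable_tree := g_sigma_algebraType tree_cylinders.

End SymmetricTree.

Definition cond_prob d (T : measurableType d) (R : realType)
    (P : probability T R) (A B : set T) : R :=
  fine (P (A `&` B)) / fine (P B).

Definition split_prob (R : realType) (fS : R -> R) (A : set R) : R :=
  \int[lebesgue_measure]_(s in A `&` `[0, 1]) fS s.

Definition split_cdf (R : realType) (fS : R -> R) (t : R) : R :=
  split_prob fS [set` `]-oo, t]].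

(* The conditional law is given by its values on cylinders: conditionally on
   {depth = d}, the 2d variables V_k, S_k are mutually independent, V_k has
   mass function fV and S_k has density fS on [0, 1]. *)
Record symmetric_tree_prior d (T : measurableType d) (R : realType)
    (P : probability T R) (p : nat)
    (fD : nat -> R) (fV : 'I_p -> R) (fS : R -> R)
    (h : {RV P >-> measurable_tree R p}) : Prop := {
  depth_law : forall n : nat,
    P (h @^-1` [set t | depth t = n]) = (fD n)%:E;
  rules_law : forall (n : nat) (v : 'I_n -> 'I_p) (A : 'I_n -> set R),
    0 < fD n -> (forall k, measurable (A k)) ->
    cond_prob P (h @^-1` tree_cylinder v A) (h @^-1` [set t | depth t = n]) =
      \prod_(k < n) (fV (v k) * split_prob fS (A k)) }.

Definition d_BART (R : realType) (p : nat) (fV : 'I_p -> R) (fS : R -> R)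
    (x x' : 'rV[R]_p) : R :=
  \sum_(v < p) fV v * `|split_cdf fS (x 0 v) - split_cdf fS (x' 0 v)|.

(* Main.v *)
Require Import Defs.
From HB Require Import structures.
From mathcomp Require Import all_boot all_order all_algebra.
From mathcomp Require Import all_classical all_reals all_analysis.

Import Order.TTheory GRing.Theory Num.Theory.
Import numFieldNormedType.Exports.

Local Open Scope classical_set_scope.
Local Open Scope ring_scope.

(** A leaf of a symmetric tree is determined by the answers to the questions
    asked level by level, so two points share a leaf exactly when no level
    separates them. The rule (v, s) fails to separate x and x' exactly when s
    lies outside the half-open interval between x_v and x'_v, which has
    probability 1 - |F_S(x_v) - F_S(x'_v)| under the split law
    ([split_prob_unseparated]). Averaging over v, one level keeps x and x'
    together with probability
    sum_v f_V(v) (1 - |F_S(x_v) - F_S(x'_v)|) = 1 - d_BART(x, x'),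
    and the levels are independent given the depth, so a tree of depth n does
    so with probability (1 - d_BART(x, x'))^n. Summing over the depth gives the
    formula.

    To turn independence given the depth into a computation with the law of
    the tree, the event of depth n and common leaf is cut into the p^n disjoint
    cylinders indexed by the choice of the split variables
    ([same_leaf_depthE]). The prior gives the mass of each cylinder as a product
    over the levels ([prior_tree_cylinder]), and the sum over all choices of
    variables of these products factors into an n-th power
    ([prior_same_leaf_depth]). *)

Section SplitLaw.
Context {R : realType} {fS : R -> R}.
Hypothesis fS_ge0 : forall s, s \in `[0, 1] -> 0 <= fS s.
Hypothesis fS_int : lebesgue_measure.-integrable `[0, 1] (EFin \o fS).

Lemma split_probU (A B : set R) : measurable A -> measurable B ->
  [disjoint A & B] ->
  split_prob fS (A `|` B) = split_prob fS A + split_prob fS B.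
Proof.
move=> mA mB AB; rewrite /split_prob setIUl Rintegral_setU //.
- exact: measurableI.
- exact: measurableI.
- rewrite -setIUl; apply: integrableS fS_int => //.
  by apply: measurableI => //; exact: measurableU.
- apply/disj_setPS => s [[As _] [Bs _]].
  by move/disj_setPS: AB; apply.
Qed.

Lemma split_prob_itv (a b : R) : a <= b ->
  split_prob fS `]a, b] = split_cdf fS b - split_cdf fS a.
Proof.
move=> ab; rewrite /split_cdf.
have -> : [set` `]-oo, b]] = `]-oo, a] `|` `]a, b] :> set R.
  apply/seteqP; split=> s /=; rewrite !in_itv /=.
    by move=> sb; case: (leP s a) => sa; [left|right].
  by case=> [/le_trans->//|/andP[]].
rewrite split_probU //; first by rewrite addrAC subrr add0r.
apply/disj_setPS => s [] /=; rewrite !in_itv /= => sa /andP[].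
by rewrite ltNge sa.
Qed.

(** The thresholds that put coordinates [a] and [b] on the same side; the
    equality is between booleans. *)
Definition unseparated (a b : R) : set R := [set s | (a < s) = (b < s)].

Lemma unseparatedC (a b : R) : unseparated a b = unseparated b a.
Proof. by apply/seteqP; split=> s /esym. Qed.

(** A threshold [s] sends [a] to the left when [a < s], strictly: this is why the
    separating interval is open at the smaller coordinate and closed at the
    larger one. *)
Lemma unseparatedE (a b : R) : a <= b -> unseparated a b = ~` `]a, b].
Proof.
move=> ab; apply/seteqP; split=> s; rewrite /unseparated /= in_itv /=.
  by move=> ->; rewrite leNgt andbN.
case: (ltP b s) => [bs _|sb /=]; first by rewrite (le_lt_trans ab).
by rewrite andbT => /negP/negbTE.
Qed.

Lemma measurable_unseparated (a b : R) : measurable (unseparated a b).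
Proof.
wlog ab : a b / a <= b.
  by move=> W; case/orP: (le_total a b) => ?; last rewrite unseparatedC; exact: W.
by rewrite unseparatedE //; exact: measurableC.
Qed.

(** The separating thresholds form the interval between [a] and [b], whose mass
    is the increment of the distribution function. *)
Lemma split_prob_unseparated (a b : R) :
  split_prob fS (unseparated a b) =
  split_prob fS setT - `|split_cdf fS a - split_cdf fS b|.
Proof.
wlog ab : a b / a <= b.
  move=> W; case/orP: (le_total a b) => ?; first exact: W.
  by rewrite unseparatedC distrC; exact: W.
rewrite unseparatedE //.
have/(congr1 (fun r => r - split_prob fS `]a, b])) :
    split_prob fS setT = split_prob fS (~` `]a, b]) + split_prob fS `]a, b].
  rewrite -split_probU ?setvU //; first exact: measurableC.
  by apply/disj_setPS => s [].
rewrite addrK => <-; rewrite split_prob_itv // distrC ger0_norm //.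
rewrite -split_prob_itv //; apply: Rintegral_ge0 => s [_ s01].
exact: fS_ge0.
Qed.

End SplitLaw.

Section SymmetricTrees.
Context {R : realType} {p : nat}.
Implicit Types (x : 'rV[R]_p) (t : symmetric_tree R p).

(** Each level can be examined on its own, because the label of the leaf that
    contains [x] is forced to be the sequence of answers of [x]. *)
Lemma same_leafE t x x' : same_leaf t x x' <->
  forall k, unseparated (x 0 (split_var k)) (x' 0 (split_var k))
    (split_val (s := t) k).
Proof.
split=> [[l [lx lx']] k|un].
  move: (lx k) (lx' k); rewrite /unseparated /=; case: (l k) => [-> -> //|].
  by rewrite !leNgt => /negbTE-> /negbTE->.
exists [ffun k => x 0 (split_var k) < split_val (s := t) k].
split=> k; rewrite ffunE; last rewrite un.
  by case: ltP.
by case: ltP.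
Qed.

(** Once the split variables are fixed, being in a common leaf constrains every
    threshold separately; this is what makes the event a finite union of
    cylinders, the only events whose law the prior prescribes. *)
Lemma same_leaf_depthE n x x' :
  [set t | depth t = n] `&` [set t | same_leaf t x x'] =
  \bigcup_(v in [set: {ffun 'I_n -> 'I_p}])
    tree_cylinder v (fun k => unseparated (x 0 (v k)) (x' 0 (v k))).
Proof.
apply/seteqP; split=> t.
  case: t => m v s /= [<-{n}] /same_leafE/= un.
  exists (finfun v) => //; exists s => /=; first by move=> k; rewrite ffunE.
  by congr SymmetricTree; apply/funext => k; rewrite ffunE.
by move=> [v _ [s un <-]]; split=> //; apply/same_leafE.
Qed.

Lemma depth_bigcup n : [set t : symmetric_tree R p | depth t = n] =
  \bigcup_(v in [set: {ffun 'I_n -> 'I_p}]) tree_cylinder v (fun=> setT).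
Proof.
apply/seteqP; split=> t.
  case: t => m v s /= <-{n}; exists (finfun v) => //; exists s => //.
  by congr SymmetricTree; apply/funext => k; rewrite ffunE.
by move=> [v _ [s un <-]].
Qed.

Lemma trivIset_tree_cylinder n
    (A : {ffun 'I_n -> 'I_p} -> 'I_n -> set R) :
  trivIset setT (fun v : {ffun 'I_n -> 'I_p} => tree_cylinder v (A v)).
Proof.
(* The split variables have a type that depends on the depth: they are read off
   a tree as a dependent pair, whose second component is injective because
   equality on [nat] is decidable. *)
pose T m := {ffun 'I_m -> 'I_p}.
pose vars t := Tagged T [ffun k => split_var (s := t) k].
apply/trivIsetP => v w _ _ /eqP neq_vw.
rewrite -subset0 => t [[s _ <-] [r _ /(congr1 vars) eq_vars]].
have eq_wv := eq_from_Tagged (T_ := T) eq_vars; case: neq_vw; apply/ffunP => k.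
by have := congr1 (fun f : T n => f k) eq_wv; rewrite !ffunE.
Qed.

Lemma measurable_tree_cylinder n (v : 'I_n -> 'I_p) (A : 'I_n -> set R) :
  (forall k, measurable (A k)) ->
  measurable (tree_cylinder v A : set (measurable_tree R p)).
Proof. by move=> mA; apply: sub_sigma_algebra; exists n, v, A. Qed.

Lemma measurable_depth n :
  measurable ([set t | depth t = n] : set (measurable_tree R p)).
Proof.
rewrite depth_bigcup; apply: fin_bigcup_measurable => // v _.
exact: measurable_tree_cylinder.
Qed.

Lemma measurable_same_leaf_depth n x x' :
  measurable ([set t | depth t = n] `&` [set t | same_leaf t x x']
    : set (measurable_tree R p)).
Proof.
rewrite same_leaf_depthE; apply: fin_bigcup_measurable => // v _.
by apply: measurable_tree_cylinder => k; exact: measurable_unseparated.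
Qed.

End SymmetricTrees.

Section Prior.
Context {R : realType} {p : nat} {fD : nat -> R} {fV : 'I_p -> R} {fS : R -> R}.
Context {disp : measure_display} {Omega : measurableType disp}.
Context {P : probability Omega R} {h : {RV P >-> measurable_tree R p}}.
Hypothesis hh : symmetric_tree_prior fD fV fS h.

Let mu : probability (measurable_tree R p) R := distribution P h.

(** Multiplying the conditional law by the mass of the depth turns it into an
    unconditional statement, which holds for every depth. *)
Lemma prior_tree_cylinder n (v : 'I_n -> 'I_p) (A : 'I_n -> set R) :
  (forall k, measurable (A k)) ->
  mu (tree_cylinder v A) =
  (fD n * \prod_(k < n) (fV (v k) * split_prob fS (A k)))%:E.
Proof.
move=> mA; have mC := measurable_tree_cylinder _ v _ mA.
have depthC : tree_cylinder v A `<=` [set t | depth t = n] by move=> t [s _ <-].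
have mu_depth : mu [set t | depth t = n] = (fD n)%:E := depth_law hh n.
have mu_finC : mu (tree_cylinder v A) \is a fin_num by exact: fin_num_measure.
(* At a depth of mass zero there is no conditional law, but the cylinder is
   contained in the null event that the tree has this depth. *)
have [fD0|fDn0] := eqVneq (fD n) 0.
  rewrite fD0 mul0r; apply/eqP; rewrite -measure_le0 -[leRHS]/(0%:E) -fD0.
  rewrite -mu_depth le_measure ?inE //; exact: measurable_depth.
have fD_gt0 : 0 < fD n.
  by rewrite lt_def fDn0 -lee_fin -mu_depth measure_ge0.
have := rules_law hh v fD_gt0 mA.
rewrite /cond_prob -preimage_setI (setIidl depthC).
rewrite -[P _]/(mu _) -[P (_ @^-1` [set t | _])]/(mu _) mu_depth /= => <-.
by rewrite mulrC divfK // fineK.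
Qed.

(** The sum over the p^n choices of split variables of a product over the levels
    is, by distributivity, the product over the levels of the sums over one
    variable; this is the independence of the levels. *)
Lemma prior_same_leaf_depth n (x x' : 'rV[R]_p) :
  mu ([set t | depth t = n] `&` [set t | same_leaf t x x']) =
  (fD n * (\sum_(v < p)
    fV v * split_prob fS (unseparated (x 0 v) (x' 0 v))) ^+ n)%:E.
Proof.
rewrite same_leaf_depthE (measure_fin_bigcup mu) //.
- rewrite (fsbigE (index_enum _)) ?index_enum_uniq //=; last first.
    by move=> v _; rewrite mem_index_enum.
  under eq_bigl do rewrite in_setT.
  under eq_bigr => v _.
    rewrite prior_tree_cylinder; first over.
    by move=> k; exact: measurable_unseparated.
  rewrite sumEFin -mulr_sumr -(bigA_distr_bigA (fun (_ : 'I_n) v =>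
    fV v * split_prob fS (unseparated (x 0 v) (x' 0 v)))).
  by rewrite prodr_const card_ord.
- exact: finite_finset.
- exact: (trivIset_tree_cylinder _ (fun v k =>
    unseparated (x 0 (v k)) (x' 0 (v k)))).
- move=> v _; apply: measurable_tree_cylinder => k.
  exact: measurable_unseparated.
Qed.

Lemma prior_same_leaf (x x' : 'rV[R]_p) :
  P (h @^-1` [set t | same_leaf t x x']) =
  (\sum_(0 <= n <oo) (fD n * (\sum_(v < p)
    fV v * split_prob fS (unseparated (x 0 v) (x' 0 v))) ^+ n)%:E)%E.
Proof.
rewrite -[LHS]/(mu [set t | same_leaf t x x']).
have -> : [set t | same_leaf t x x'] =
    \bigcup_n ([set t | depth t = n] `&` [set t | same_leaf t x x']).
  apply/seteqP; split=> t; first by move=> st; exists (depth t).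
  by move=> [n _ []].
rewrite (measure_semi_bigcup mu).
- by apply: eq_eseriesr => n _; exact: prior_same_leaf_depth.
- by move=> n; exact: measurable_same_leaf_depth.
- apply/trivIsetP => m n _ _ /eqP neq_mn.
  rewrite -subset0 => t [[depth_m _] [depth_n _]].
  by apply: neq_mn; rewrite -depth_m.
- by apply: bigcupT_measurable => n; exact: measurable_same_leaf_depth.
Qed.

End Prior.

Theorem proposition3p2 (R : realType) (p : nat) (hp : (1 <= p)%N)
  (fD : nat -> R) (hfD0 : fD 0%N = 0) (hfD_ge0 : forall k, 0 <= fD k)
  (hfD_sum : (\sum_(1 <= k <oo) (fD k)%:E = 1)%E)
  (fV : 'I_p -> R) (hfV_gt0 : forall v, 0 < fV v)
  (hfV_sum : \sum_(v < p) fV v = 1)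
  (fS : R -> R) (hfS_cont : {within `[0, 1], continuous fS})
  (hfS_gt0 : forall s, s \in `[0, 1] -> 0 < fS s)
  (hfS_int : \int[lebesgue_measure]_(s in `[0, 1]) fS s = 1)
  (disp : measure_display) (Omega : measurableType disp)
  (P : probability Omega R) (h : {RV P >-> measurable_tree R p})
  (hh : symmetric_tree_prior fD fV fS h)
  (x x' : 'rV[R]_p)
  (hx : forall v, x 0 v \in `[0, 1]) (hx' : forall v, x' 0 v \in `[0, 1]) :
  P (h @^-1` [set t | same_leaf t x x']) =
  (\sum_(1 <= k <oo) ((1 - d_BART fV fS x x') ^+ k * fD k)%:E)%E.
Proof.
have fS_int : lebesgue_measure.-integrable `[0, 1] (EFin \o fS).
  by apply: continuous_compact_integrable => //; exact: segment_compact.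
have fS_ge0 s : s \in `[0, 1] -> 0 <= fS s by move=> /hfS_gt0/ltW.
rewrite (prior_same_leaf hh).
have level_prob :
    \sum_(v < p) fV v * split_prob fS (unseparated (x 0 v) (x' 0 v)) =
    1 - d_BART fV fS x x'.
  rewrite /d_BART -hfV_sum -sumrB; apply: eq_bigr => v _.
  rewrite split_prob_unseparated // mulrBr; congr (_ - _).
  by rewrite /split_prob setTI hfS_int mulr1.
have level_prob_ge0 : 0 <= 1 - d_BART fV fS x x'.
  rewrite -level_prob; apply: sumr_ge0 => v _; apply: mulr_ge0.
    exact: ltW.
  by apply: Rintegral_ge0 => s [_ s01]; exact: fS_ge0.
(* The law of the tree gives a series that starts at depth 0, where the mass
   vanishes; nonnegative terms are what allows the first one to be split off. *)
rewrite nneseries_recl //; last first.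
  by move=> n _; rewrite level_prob lee_fin mulr_ge0 // exprn_ge0.
rewrite hfD0 mul0r add0e; apply: eq_eseriesr => n _.
by rewrite level_prob mulrC.
Qed.
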